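(* For all integers $a\geq 0$ and $b\geq 0$: $$n(a,b,3)=\begin{cases}\infty & \text{if } a<2,\\ 6 & \text{if } a=2 \text{ and } b\in\{1,2\},\\ a+b+1 & \text{if } a=2 \text{ and } b\notin\{1,2\},\\ a+b+1 & \text{if } a\geq 3 \text{ and } ab \text{ is even},\\ a+b+2 & \text{if } a\geq 3 \text{ and } ab \text{ is odd}.\end{cases}$$
   Context: A weighted graph (wgraph) is a pair $G=(L,H)$ of simple finite graphs with $V(L)=V(H)$ and $E(L)\cap E(H)=\varnothing$; edges of $L$ are light (weight 1) and edges of $H$ are heavy (weight 2). A wcycle is a cycle (of length at least 3) in the graph with edge set $E(L)\cup E(H)$; its weight is the sum of the weights of its edges. The girth of $G$ is the minimum weight of a wcycle. $G$ is $(a,b)$-regular if $L$ is $a$-regular and $H$ is $b$-regular. An $(a,b,g)$-wgraph is an $(a,b)$-regular wgraph of girth $g$. $n(a,b,g)$ denotes the minimum order of an $(a,b,g)$-wgraph, and $n(a,b,g)=\infty$ if none exists. *)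

(* Defs.v *)
From mathcomp Require Import all_boot boolp.

Set Implicit Arguments.
Unset Strict Implicit.
Unset Printing Implicit Defensive.

(* Minimum in the extended naturals: [Some n] is the finite value [n] and      *)
(* [None] is infinity, the minimum of the empty set.                           *)
Definition minimum (P : nat -> Prop) : option nat :=
  match pselect (exists n, `[< P n >]) with
  | left exP => Some (ex_minn exP)
  | right _ => None
  end.

Record sgraph (V : finType) := SGraph {
  edge : rel V;
  edge_sym : symmetric edge;
  edge_irrefl : irreflexive edge }.

Definition regular (V : finType) (G : sgraph V) (d : nat) : Prop :=
  forall x, #|[set y | edge G x y]| = d.

Record wgraph (V : finType) := WGraph {
  light : sgraph V;
  heavy : sgraph V;
  light_heavy_disjoint : forall x y, ~~ (edge light x y && edge heavy x y) }.

Definition adj (V : finType) (G : wgraph V) : rel V :=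
  fun x y => edge (light G) x y || edge (heavy G) x y.

Definition edge_weight (V : finType) (G : wgraph V) (x y : V) : nat :=
  if edge (heavy G) x y then 2 else if edge (light G) x y then 1 else 0.

(* A cycle is given by the sequence of its distinct vertices in cyclic order.  *)
Definition wcycle (V : finType) (G : wgraph V) (c : seq V) : Prop :=
  2 < size c /\ ucycle (adj G) c.

Definition weight (V : finType) (G : wgraph V) (c : seq V) : nat :=
  \sum_(x <- c) edge_weight G x (next c x).

Definition girth (V : finType) (G : wgraph V) : option nat :=
  minimum (fun w => exists2 c, wcycle G c & weight G c = w).

Definition is_abg_wgraph (a b g : nat) (V : finType) (G : wgraph V) : Prop :=
  [/\ regular (light G) a, regular (heavy G) b & girth G = Some g].

Definition min_order (a b g : nat) : option nat :=
  minimum (fun m => exists (V : finType) (G : wgraph V),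
    #|V| = m /\ is_abg_wgraph a b g G).

(* Main.v *)
(* A wgraph has girth 3 iff its light graph L has a triangle, so a >= 2, and   *)
(* a + b + 1 vertices are always needed.  If a and b are odd, this many        *)
(* vertices violate the handshake lemma.  If a = 2, a triangle of L is a whole *)
(* component of L, and a vertex outside it has two light neighbours outside,   *)
(* so the order is either 3 or at least 6.                                     *)
(* Constructions: for even order, a one-factorization of the complete graph in *)
(* which the first three factors contain a triangle; for odd order and a >= 3, *)
(* both degrees are even and circulant graphs on Z/n serve; for a = 2, L is a  *)
(* triangle plus a b-cycle and H its complement, except that for b = 1 and     *)
(* b = 2 circulant graphs on Z/6 serve.                                        *)
Require Import Defs.
From mathcomp Require Import all_boot.
From mathcomp Require Import boolp ssralg zmodp zify.

Set Implicit Arguments.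
Unset Strict Implicit.
Unset Printing Implicit Defensive.

(** Edge weights are positive, so girth 3 means a triangle of light edges ([girth3P]), and the
    question becomes one about regular graphs on few vertices. The lower bounds count the neighbours
    of one vertex ([order_gt_degrees]), use parity ([handshake]) and, for light degree 2, the
    isolation of the triangle ([regular2_triangle_order]). Most constructions come from
    [latin_wgraph]: a square of labels with permutations as rows turns sets of labels into regular
    graphs. The labels are differences in [circulant_wgraph] and colours in [even_order_wgraph];
    [light_degree2_wgraph] takes a complement instead. *)

Lemma minimum_Some (P : nat -> Prop) n :
  minimum P = Some n <-> P n /\ forall m, P m -> n <= m.
Proof.
rewrite /minimum; case: pselect => [exP | noP]; last first.
  by split=> // -[Pn _]; case: noP; exists n; apply/asboolP.
case: ex_minnP => k /asboolP Pk kmin; split=> [[<-] | [Pn nmin]].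
  by split=> // m Pm; apply/kmin/asboolP.
congr Some; apply/eqP; rewrite eqn_leq (nmin _ Pk) andbT.
exact/kmin/asboolP.
Qed.

Lemma minimum_None (P : nat -> Prop) : (forall n, ~ P n) -> minimum P = None.
Proof.
move=> noP; case E: (minimum P) => [n|//].
by case/minimum_Some: E => /noP.
Qed.

(** * Girth 3 and light triangles *)

Definition has_triangle (V : finType) (G : sgraph V) : Prop :=
  exists x y z, [/\ edge G x y, edge G y z & edge G z x].

Lemma edge_neq (V : finType) (G : sgraph V) x y : edge G x y -> x != y.
Proof. by apply: contraTneq => ->; rewrite edge_irrefl. Qed.

Lemma light_weight (V : finType) (G : wgraph V) x y :
  edge (light G) x y -> edge_weight G x y = 1.
Proof.
move=> lxy; rewrite /edge_weight lxy.
by have := light_heavy_disjoint G x y; rewrite lxy /= => /negbTE ->.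
Qed.

Lemma adj_weight_gt0 (V : finType) (G : wgraph V) x y :
  adj G x y -> 0 < edge_weight G x y.
Proof. by rewrite /adj /edge_weight orbC; case: ifP => //= _ ->. Qed.

Lemma weight1_light (V : finType) (G : wgraph V) x y :
  edge_weight G x y = 1 -> edge (light G) x y.
Proof. by rewrite /edge_weight; case: ifP => // _; case: ifP. Qed.

Lemma size_le_weight (V : finType) (G : wgraph V) c :
  wcycle G c -> size c <= weight G c.
Proof.
case=> _ /andP[cyc _]; rewrite /weight -sum1_size big_seq [leqRHS]big_seq.
by apply: leq_sum => x xc; apply/adj_weight_gt0/(next_cycle cyc).
Qed.

(** The weight of a wcycle is at least its length, hence at least 3; equality leaves three edges of
    weight 1. *)
Lemma girth3P (V : finType) (G : wgraph V) :
  girth G = Some 3 <-> has_triangle (light G).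
Proof.
split=> [/minimum_Some[[c Cc wc] _] | [x [y [z [xy yz zx]]]]]; last first.
  apply/minimum_Some; split=> [|_ [c Cc <-]]; last first.
    by apply: leq_trans (size_le_weight Cc); case: Cc.
  have nxy := edge_neq xy; have nyz := edge_neq yz; have nzx := edge_neq zx.
  exists [:: x; y; z]; first split=> //.
    rewrite /ucycle /= /adj xy yz zx /= !inE negb_or nxy nyz.
    by rewrite eq_sym nzx.
  rewrite /weight !big_cons big_nil /= !eqxx [y == x]eq_sym (negbTE nxy).
  rewrite (negbTE nzx) [z == y]eq_sym (negbTE nyz).
  by rewrite !light_weight.
have := size_le_weight Cc; rewrite wc.
case: Cc => + /andP[]; case: c wc => [|x [|y [|z [|//]]]] //= + _.
rewrite !inE negb_or.
move=> + /and4P[/adj_weight_gt0 xy /adj_weight_gt0 yz /adj_weight_gt0 zx _].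
rewrite /weight !big_cons big_nil /= !eqxx.
move=> + /and3P[/andP[nxy nxz] nyz _] _.
rewrite [y == x]eq_sym (negbTE nxy) [z == x]eq_sym (negbTE nxz).
rewrite [z == y]eq_sym (negbTE nyz) => w3.
by exists x, y, z; split; apply: weight1_light; lia.
Qed.

Lemma min_order_Some a b n :
    (forall (V : finType) (G : wgraph V), is_abg_wgraph a b 3 G -> n <= #|V|) ->
    (exists (V : finType) (G : wgraph V), #|V| = n /\ is_abg_wgraph a b 3 G) ->
  min_order a b 3 = Some n.
Proof.
by move=> lb ex; apply/minimum_Some; split=> // m [V [G [<-]]]; apply: lb.
Qed.

(** * Lower bounds on the order *)

Lemma triangle_degree (V : finType) (G : sgraph V) a :
  regular G a -> has_triangle G -> 1 < a.
Proof.
move=> reg [x [y [z [xy yz zx]]]]; rewrite -(reg x).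
have <- : #|[set y; z]| = 2 by rewrite cards2 (edge_neq yz).
apply/subset_leq_card/subsetP => w; rewrite !inE => /orP[] /eqP -> //.
by rewrite edge_sym.
Qed.

Lemma order_gt_degrees (V : finType) (G : wgraph V) a b :
  is_abg_wgraph a b 3 G -> a + b < #|V|.
Proof.
(* The triangle supplies a vertex [x]; its light and heavy neighbourhoods are disjoint and miss
   [x]. *)
case=> rL rH /girth3P[x _]; rewrite -(rL x) -(rH x).
set A := [set y | _]; set B := [set y | edge (heavy G) _ _].
have /eqP : #|A :&: B| = 0.
  apply: eq_card0 => y; rewrite !inE.
  exact/negbTE/light_heavy_disjoint.
rewrite -leqn0 => AB0; rewrite -cardsT.
apply: leq_ltn_trans (_ : #|A :|: B| < _).
  by have := cardsUI A B; lia.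
apply/proper_card/properP; split=> //.
by exists x; rewrite // !inE !edge_irrefl.
Qed.

(** Ordered adjacent pairs split into those increasing in the enumeration of [V] and their images
    under [swap], so their number is even. *)
Lemma handshake (V : finType) (G : sgraph V) d :
  regular G d -> ~~ odd (#|V| * d).
Proof.
move=> reg; pose r := @enum_rank V.
pose A := [set p : V * V | edge G p.1 p.2 && (r p.1 < r p.2)].
pose swap (p : V * V) := (p.2, p.1).
have swapI : injective swap by case=> ? ? [? ?] [-> ->].
have -> : #|V| * d = #|A| + #|swap @: A|.
  have -> : #|V| * d = \sum_(x : V) \sum_(y | edge G x y) 1.
    by rewrite -sum_nat_const; apply: eq_bigr => x _; rewrite sum1dep_card reg.
  rewrite pair_big_dep /=.
  rewrite (bigID [pred p : V * V | r p.1 < r p.2]) /=.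
  rewrite -[#|A|]sum1_card -[#|swap @: A|]sum1_card.
  congr (_ + _); first by apply: eq_bigl => p; rewrite inE.
  apply: eq_bigl => -[x y] /=; apply/idP/imsetP => [/andP[xy] | [[u v]]].
    rewrite -leqNgt leq_eqVlt => /orP[/eqP/val_inj/enum_rank_inj yx|lt].
      by rewrite yx edge_irrefl in xy.
    by exists (y, x) => //; rewrite inE /= edge_sym xy.
  by rewrite inE /= => /andP[uv lt] [-> ->]; rewrite edge_sym uv -leqNgt ltnW.
by rewrite card_imset // oddD addbb.
Qed.

(** The triangle uses up both neighbours of each of its vertices, so no edge leaves it. A vertex
    outside, together with its two neighbours, then gives three more vertices. *)
Lemma regular2_triangle_order (V : finType) (G : sgraph V) :
  regular G 2 -> has_triangle G -> 3 < #|V| -> 5 < #|V|.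
Proof.
move=> reg [x [y [z [xy yz zx]]]] V4.
pose T := [set x; y; z].
have cT : #|T| = 3.
  by rewrite /T -setUA cardsU1 cards2 !inE negb_or (edge_neq xy) (edge_neq yz)
     eq_sym (edge_neq zx).
have nbrs u v w : edge G u v -> edge G w u -> v != w ->
    forall t, edge G u t -> t \in [set v; w].
  move=> uv wu vw t ut.
  have /eqP -> : [set v; w] == [set t | edge G u t].
    rewrite eqEcard reg cards2 vw leqnn andbT.
    by apply/subsetP => s; rewrite !inE => /orP[] /eqP -> //; rewrite edge_sym.
  by rewrite inE.
have closed u t : u \in T -> edge G u t -> t \in T.
  rewrite !inE -orbA => /or3P[] /eqP -> e.
  - have := nbrs _ _ _ xy zx (edge_neq yz) _ e.
    by rewrite !inE => /orP[] ->; rewrite ?orbT.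
  - have := nbrs _ _ _ yz xy (edge_neq zx) _ e.
    by rewrite !inE => /orP[] ->; rewrite ?orbT.
  - have := nbrs _ _ _ zx yz (edge_neq xy) _ e.
    by rewrite !inE => /orP[] ->; rewrite ?orbT.
have /set0Pn[w] : ~: T != set0.
  by rewrite -card_gt0; have := cardsC T; rewrite cT; lia.
rewrite inE => wT.
have : #|w |: [set t | edge G w t]| <= #|~: T|.
  apply/subset_leq_card/subsetP => t.
  rewrite in_setU1 !in_setC inE => /orP[/eqP -> // | wt].
  by apply: contra wT => tT; apply: closed tT _; rewrite edge_sym.
rewrite cardsU1 reg inE edge_irrefl.
by have := cardsC T; rewrite cT; lia.
Qed.

(** * From label sets to wgraphs *)

(* Reading [lab x y] as the label of [y] seen from [x], an edge set is given by *)
(* a set of labels; this covers both Cayley graphs and edge colourings.         *)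
Lemma latin_wgraph (V : finType) (lab : V -> V -> V) (C D : {set V}) :
    (forall x, injective (lab x)) ->
    (forall x y, lab x y \in C -> lab y x \in C) ->
    (forall x y, lab x y \in D -> lab y x \in D) ->
    [disjoint C & D] -> (forall x, lab x x \notin C :|: D) ->
    (exists x y z, [/\ lab x y \in C, lab y z \in C & lab z x \in C]) ->
  exists G : wgraph V, is_abg_wgraph #|C| #|D| 3 G.
Proof.
move=> labI symC symD disCD irr tri.
have sym (E : {set V}) : (forall x y, lab x y \in E -> lab y x \in E) ->
    symmetric (fun x y => lab x y \in E).
  by move=> H x y; apply/idP/idP; apply: H.
have irrC : irreflexive (fun x y => lab x y \in C).
  by move=> x; have := irr x; rewrite inE; case/norP => /negbTE.
have irrD : irreflexive (fun x y => lab x y \in D).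
  by move=> x; have := irr x; rewrite inE; case/norP => _ /negbTE.
have reg (E : {set V}) (sE : symmetric (fun x y => lab x y \in E)) iE :
    regular (SGraph sE iE) #|E|.
  (* An injective [lab x] is a permutation of the finite type [V], so preimages keep their
     cardinality. *)
  move=> x /=; have -> : [set y | lab x y \in E] = lab x @^-1: E.
    by apply/setP => y; rewrite !inE.
  by apply: (on_card_preimset (onW_bij _ (injF_bij (labI x)))).
have dis x y : ~~ ((lab x y \in C) && (lab x y \in D)).
  by apply/negP => /andP[/(disjointFr disCD) ->].
exists (@WGraph V (SGraph (sym C symC) irrC) (SGraph (sym D symD) irrD) dis).
by split; [exact: reg | exact: reg | exact/girth3P].
Qed.

Lemma complement_wgraph (V : finType) (L : sgraph V) a :
    regular L a -> has_triangle L ->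
  exists G : wgraph V, is_abg_wgraph a (#|V| - a.+1) 3 G.
Proof.
move=> reg tri; pose e x y := (x != y) && ~~ edge L x y.
have eS : symmetric e by move=> x y; rewrite /e eq_sym edge_sym.
have eI : irreflexive e by move=> x; rewrite /e eqxx.
have dis x y : ~~ (edge L x y && e x y).
  by rewrite /e; case: edge; rewrite ?andbF.
exists (@WGraph V L (SGraph eS eI) dis); split=> //; last exact/girth3P.
move=> x /=; have -> : [set y | e x y] = ~: (x |: [set y | edge L x y]).
  by apply/setP => y; rewrite !inE negb_or /e eq_sym.
have := cardsC (x |: [set y | edge L x y]).
by rewrite cardsU1 reg inE edge_irrefl /=; lia.
Qed.


(** * Circulant constructions *)

Lemma card_ord_lt n k : k <= n -> #|[set i : 'I_n | i < k]| = k.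
Proof.
move=> kn; have injw : injective (widen_ord kn).
  by move=> i j /(congr1 val) /= /val_inj.
rewrite -[RHS]card_ord -(card_codom injw); apply: eq_card => i; rewrite inE.
apply/idP/codomP => [ik | [j ->]]; last exact: ltn_ord j.
by exists (Ordinal ik); apply: val_inj.
Qed.

Lemma card_ord_itv n lo hi :
  lo <= hi <= n -> #|[set i : 'I_n | lo <= i < hi]| = hi - lo.
Proof.
move=> /andP[lohi hin].
have -> : [set i : 'I_n | lo <= i < hi] =
    [set i : 'I_n | i < hi] :\: [set i : 'I_n | i < lo].
  by apply/setP => i; rewrite !inE -leqNgt.
rewrite cardsDS ?card_ord_lt ?(leq_trans lohi) //.
by apply/subsetP => i; rewrite !inE => /leq_trans; apply.
Qed.

Lemma circulant_wgraph n (C D : {set 'I_n.+1}) :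
    (forall d, d \in C -> - d \in C)%R -> (forall d, d \in D -> - d \in D)%R ->
    [disjoint C & D] -> (0%R \notin C :|: D) ->
    (exists d e, [/\ d \in C, e \in C & d + e \in C])%R ->
  exists G : wgraph 'I_n.+1, is_abg_wgraph #|C| #|D| 3 G.
Proof.
move=> symC symD dis irr [d [e [Cd Ce Cde]]].
apply: (@latin_wgraph 'I_n.+1 (fun x y => y - x)%R) => //.
- by move=> x y z /GRing.addIr.
- by move=> x y /symC; rewrite GRing.opprB.
- by move=> x y /symD; rewrite GRing.opprB.
- by move=> x; rewrite GRing.subrr.
(* The differences around this triangle are [d], [e] and [- (d + e)]. *)
exists 0%R, d, (d + e)%R; split.
- by rewrite GRing.subr0.
- by rewrite GRing.addrC GRing.addKr.
- by rewrite GRing.sub0r; apply: symC.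
Qed.

Lemma oppZp_val n (d : 'I_n.+1) :
  d != 0%R -> (- d)%R = n.+1 - d :> nat.
Proof.
move=> d0; rewrite /= modn_small //.
have : 0 < d by rewrite lt0n; apply: contra d0 => /eqP d0; apply/eqP/val_inj.
lia.
Qed.

Lemma odd_order_wgraph a b :
    3 <= a -> ~~ odd a -> ~~ odd b ->
  exists (V : finType) (G : wgraph V), #|V| = a + b + 1 /\ is_abg_wgraph a b 3 G.
Proof.
move=> a3 oa ob; pose n := a + b; pose k := a./2; pose l := b./2.
have ak : a = k.*2 by have := odd_double_half a; rewrite (negbTE oa).
have bl : b = l.*2 by have := odd_double_half b; rewrite (negbTE ob).
(* Heavy differences are the [b] middle residues; the light ones are ±1, ..., ±[k]. Since [a] is
   even and at least 3, [k] is at least 2, and 1 + 1 = 2 closes a triangle. *)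
pose D := [set d : 'I_n.+1 | k.+1 <= d < n.+1 - k].
pose C := [set d : 'I_n.+1 | (d != 0%R) && (d \notin D)].
have cD : #|D| = b by rewrite card_ord_itv /n; lia.
have cC : #|C| = a.
  have -> : C = ~: ((0%R : 'I_n.+1) |: D) by apply/setP => d; rewrite !inE negb_or.
  have := cardsC ((0%R : 'I_n.+1) |: D); rewrite cardsU1 cD card_ord inE /= /n; lia.
have symD d : d \in D -> (- d)%R \in D.
  have [-> | d0] := eqVneq d 0%R; first by rewrite GRing.oppr0.
  by rewrite !inE oppZp_val //; lia.
have symC d : d \in C -> (- d)%R \in C.
  rewrite inE => /andP[d0 dD]; rewrite inE GRing.oppr_eq0 d0 /=.
  by apply: contra dD => /symD; rewrite GRing.opprK.
have [|||G] := circulant_wgraph symC symD; last first.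
- by rewrite cC cD => GP; exists 'I_n.+1, G; rewrite card_ord addn1.
- have n1 : 1 < n.+1 by rewrite /n; lia.
  have n2 : 2 < n.+1 by rewrite /n; lia.
  exists (Ordinal n1), (Ordinal n1).
  have -> : (Ordinal n1 + Ordinal n1)%R = Ordinal n2.
    by apply: val_inj; rewrite /= modn_small.
  by split; rewrite !inE /=; lia.
- by rewrite !inE eqxx.
- by rewrite disjoint_subset; apply/subsetP => d; rewrite !inE => /andP[].
Qed.

Lemma order6_wgraph b : b = 1 \/ b = 2 ->
  exists (V : finType) (G : wgraph V), #|V| = 6 /\ is_abg_wgraph 2 b 3 G.
Proof.
pose o i : 'I_6 := inord i.
have oK i : i < 6 -> o i = i :> nat by move=> i6; rewrite /o inordK.
(* [C] gives two disjoint triangles, the even and the odd residues. The heavy set below is a perfect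
   matching (difference 3) or a 6-cycle (differences ±1). *)
pose C := [set o 2; o 4].
have cC : #|C| = 2 by rewrite cards2 -val_eqE /= !oK.
have symC d : d \in C -> (- d)%R \in C.
  rewrite !inE -!val_eqE /= !oK //.
  by case: d => [[|[|[|[|[|[|?]]]]]] ?].
have tri : exists d e, [/\ d \in C, e \in C & (d + e)%R \in C].
  by exists (o 2), (o 2); rewrite !inE -!val_eqE /= !oK.
suff D_exists : b = 1 \/ b = 2 -> exists D : {set 'I_6},
   [/\ #|D| = b, forall d, d \in D -> (- d)%R \in D,
       [disjoint C & D] & 0%R \notin C :|: D].
  move=> /D_exists[D [cD symD dis irr]].
  have [G] := circulant_wgraph symC symD dis irr tri.
  by rewrite cC cD => GP; exists 'I_6, G; rewrite card_ord.
case=> ->; [exists [set o 3] | exists [set o 1; o 5]]; split.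
- by rewrite cards1.
- move=> d; rewrite !inE -!val_eqE /= !oK //.
  by case: d => [[|[|[|[|[|[|?]]]]]] ?].
- rewrite disjoint_subset; apply/subsetP => d; rewrite !inE -!val_eqE /= !oK //.
  by case: d => [[|[|[|[|[|[|?]]]]]] ?].
- by rewrite !inE -!val_eqE /= !oK.
- by rewrite cards2 -val_eqE /= !oK.
- move=> d; rewrite !inE -!val_eqE /= !oK //.
  by case: d => [[|[|[|[|[|[|?]]]]]] ?].
- rewrite disjoint_subset; apply/subsetP => d; rewrite !inE -!val_eqE /= !oK //.
  by case: d => [[|[|[|[|[|[|?]]]]]] ?].
- by rewrite !inE -!val_eqE /= !oK.
Qed.

(** * One-factorizations for even order *)

Lemma even_order_wgraph n a b :
    odd n -> 3 <= a -> a + b <= n ->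
  exists (V : finType) (G : wgraph V), #|V| = n.+1 /\ is_abg_wgraph a b 3 G.
Proof.
case: n => [//|m] om a3 abm; set p := m.+1 in om abm *.
(* Doubling is injective modulo the odd number [p]; this keeps the colours at the point at infinity
   distinct. *)
have dblI : injective (fun i : 'I_p => i + i)%R.
  move=> i j /(congr1 val) /= dij; apply: val_inj => /=.
  have red (k : 'I_p) : (k + k) %% p = if k + k < p then k + k else k + k - p.
    case: ltnP => [/modn_small // | pk].
    rewrite -{1}(subnK pk) modnDr modn_small //; have := ltn_ord k; lia.
  have := ltn_ord i; have := ltn_ord j.
  move: dij; rewrite !red; have := odd_double_half p; rewrite om.
  case: (ltnP (i + i)); case: (ltnP (j + j)); lia.
(* One-factorization of the complete graph on Z/p and a point at infinity      *)
(* [None]: [ij] has colour [i + j] and [i None] has colour [2i].  The triangle *)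
(* [None, 0, 1] has colours 0, 1, 2.                                           *)
pose f (x y : option 'I_p) : 'I_p :=
  match x, y with
  | Some i, Some j => i + j
  | Some i, None | None, Some i => i + i
  | None, None => 0
  end%R.
(* The extra label [None] on the diagonal makes every row a permutation of [option 'I_p]. *)
pose lab x y := if x == y then None else Some (f x y).
have fC x y : f x y = f y x by case: x y => [i|] [j|] //=; rewrite GRing.addrC.
have labC x y : lab x y = lab y x by rewrite /lab eq_sym fC.
have labI x : injective (lab x).
  move=> y z; rewrite /lab.
  case: eqVneq => [->|xy]; case: eqVneq => [->|xz] // [].
  case: x y z xy xz => [i|] [j|] [k|] //=.
  - by move=> _ _ /GRing.addrI ->.
  - by move=> ij _ /GRing.addrI ji; rewrite ji eqxx in ij.
  - by move=> _ ik /GRing.addrI ki; rewrite ki eqxx in ik.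
  - by move=> _ _ /dblI ->.
pose S (A : {set 'I_p}) : {set option 'I_p} := Some @: A.
have SE A i : (Some i \in S A) = (i \in A) by rewrite mem_imset // => ? ? [].
have S0 A : (None \in S A) = false by apply/negP => /imsetP[].
have cS A : #|S A| = #|A| by rewrite card_imset // => ? ? [].
pose A := [set i : 'I_p | 0 <= i < a].
pose B := [set i : 'I_p | a <= i < a + b].
have cA : #|A| = a by rewrite card_ord_itv; lia.
have cB : #|B| = b by rewrite card_ord_itv; lia.
have [|||||G] := @latin_wgraph _ lab (S A) (S B) labI; last first.
- by rewrite !cS cA cB => GP; exists (option 'I_p), G; rewrite card_option card_ord.
- have p1 : 1 < p by lia.
  have p2 : 2 < p by lia.
  exists None, (Some 0%R), (Some (Ordinal p1)).
  split; rewrite /lab /= SE inE /= modn_small; lia.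
- by move=> x; rewrite /lab eqxx inE !S0.
- rewrite disjoint_subset; apply/subsetP => -[i|]; rewrite !inE ?SE ?S0 // !inE.
  lia.
- by move=> x y; rewrite labC.
- by move=> x y; rewrite labC.
Qed.

(** * Light degree 2: a triangle plus a cycle *)

(** The graph is the union of the cycles of the permutation [s]; the condition [s x != t x] excludes
    cycles of length 1 and 2. *)
Lemma perm_regular2 (V : finType) (s t : V -> V) :
    cancel s t -> cancel t s -> (forall x, s x != t x) ->
  exists L : sgraph V,
    (edge L =2 fun x y => (y == s x) || (y == t x)) /\ regular L 2.
Proof.
move=> sK tK s_neq_t; pose e x y := (y == s x) || (y == t x).
have eS : symmetric e.
  by move=> x y; rewrite /e orbC ![y == _]eq_sym (can2_eq tK sK) (can2_eq sK tK).
have eI : irreflexive e.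
  move=> x; rewrite /e -(can2_eq sK tK) eq_sym orbb.
  by apply: contraNF (s_neq_t x) => /eqP sx; rewrite sx -{2}sx sK.
exists (SGraph eS eI); split=> // x /=.
have -> : [set y | e x y] = [set s x; t x] by apply/setP => y; rewrite !inE.
by rewrite cards2 s_neq_t.
Qed.

Lemma ordSS_neq n (i : 'I_n) : 2 < n -> ordS (ordS i) != i.
Proof.
move=> n2; rewrite -val_eqE /=; rewrite -addn1 modnDml addn1 -addn2.
have := ltn_ord i; case: (ltnP (i + 2) n) => [/modn_small -> | h]; first by lia.
by move=> lt; rewrite -(subnK h) modnDr modn_small; lia.
Qed.

Lemma ordS_neq_pred n (i : 'I_n) : 2 < n -> ordS i != ord_pred i.
Proof. by move/(ordSS_neq i); apply: contra_neq => ->; rewrite ord_predK. Qed.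

Lemma light_degree2_wgraph b : b != 1 -> b != 2 ->
  exists (V : finType) (G : wgraph V), #|V| = 2 + b + 1 /\ is_abg_wgraph 2 b 3 G.
Proof.
move=> b1 b2; pose V := ('I_3 + 'I_b)%type.
pose s (x : V) : V :=
  match x with inl i => inl (ordS i) | inr i => inr (ordS i) end.
pose t (x : V) : V :=
  match x with inl i => inl (ord_pred i) | inr i => inr (ord_pred i) end.
have sK : cancel s t by case=> i /=; rewrite ordSK.
have tK : cancel t s by case=> i /=; rewrite ord_predK.
have s_neq_t x : s x != t x.
  (* An element of ['I_b] forces [b] to be positive, hence at least 3; for [b = 0] the second cycle
     is empty. *)
  by case: x => i; apply: ordS_neq_pred => //; have := ltn_ord i; lia.
have [L [LE reg]] := perm_regular2 sK tK s_neq_t.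
have tri : has_triangle L.
  pose o i : V := inl (inord i : 'I_3).
  exists (o 0), (o 1), (o 2); rewrite !LE /=.
  by split; apply/orP; left; apply/eqP; congr inl; apply: val_inj; rewrite /= !inordK.
have [G] := complement_wgraph reg tri.
have cV : #|{: V}| = 2 + b + 1 by rewrite card_sum !card_ord; lia.
by rewrite cV (_ : 2 + b + 1 - 3 = b) => [GP|]; [exists V, G | lia].
Qed.

Theorem theorem11 (a b : nat) :
  [/\ a < 2 -> min_order a b 3 = None,
      a = 2 -> b = 1 \/ b = 2 -> min_order a b 3 = Some 6,
      a = 2 -> ~ (b = 1 \/ b = 2) -> min_order a b 3 = Some (a + b + 1),
      3 <= a -> ~~ odd (a * b) -> min_order a b 3 = Some (a + b + 1) &
      3 <= a -> odd (a * b) -> min_order a b 3 = Some (a + b + 2)].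
Proof.
split.
- move=> a2; apply: minimum_None => _ [V [G [_ [regL _ /girth3P tri]]]].
  by have := triangle_degree regL tri; rewrite ltnNge -ltnS a2.
- move=> -> b12; apply: min_order_Some (order6_wgraph b12) => V G GP.
  have [regL _ /girth3P tri] := GP.
  apply: regular2_triangle_order regL tri _.
  have := order_gt_degrees GP; lia.
- move=> -> b12; apply: min_order_Some => [V G /order_gt_degrees|]; first by lia.
  by apply: light_degree2_wgraph; apply/eqP => b0; apply: b12; [left | right].
- move=> a3 ab; apply: min_order_Some => [V G /order_gt_degrees|]; first by lia.
  (* If [a + b] is odd, the order is even; otherwise [a] and [b] have equal parity, and an even
     product makes both even. *)
  case oab: (odd (a + b)).
    by rewrite addn1; apply: even_order_wgraph.
  by move: oab ab; rewrite oddD oddM => oab ab; apply: odd_order_wgraph => //;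
     move: oab ab; case: odd; case: odd.
- rewrite oddM => a3 /andP[oa ob]; apply: min_order_Some => [V G GP|].
    (* Order [a + b + 1] would be odd, and so would its product with the light degree [a]. *)
    have := order_gt_degrees GP; have [/handshake + _ _] := GP.
    rewrite oddM oa andbT => eV.
    rewrite leq_eqVlt => /orP[/eqP V1 | ]; last by lia.
    by move: eV; rewrite -V1 /= oddD oa ob.
  by rewrite addn2; apply: even_order_wgraph => //=; rewrite ?oddD ?oa ?ob.
Qed.
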